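(* There is a function $h_0\in\omega^\omega$ such that for every $h\in\omega^\omega$ with $h(n)\ge h_0(n)$ for all $n$ (i.e., for every $h\in\omega^\omega$ growing fast enough), $$(\omega^\omega,\Phi_h,\in^\infty)\ \le_T\ (D,\mathrm{Sym}(\omega),R)\ \le_T\ (\mathcal M,2^\omega,\not\ni).$$
   Context: Relational systems: a relational system is a triple $\mathcal A=(A_-,A_+,A)$ with $A\subseteq A_-\times A_+$ such that for every $a_-\in A_-$ there is $a_+\in A_+$ with $a_-\,A\,a_+$, and for every $a_+\in A_+$ there is $a_-\in A_-$ for which $a_-\,A\,a_+$ fails. $\mathcal A\le_T\mathcal B$ (Tukey reducibility), for $\mathcal B=(B_-,B_+,B)$, means that there are functions $\varphi_-:A_-\to B_-$ and $\varphi_+:B_+\to A_+$ such that for all $a_-\in A_-$, $b_+\in B_+$: $\varphi_-(a_-)\,B\,b_+$ implies $a_-\,A\,\varphi_+(b_+)$. Density: $n\in\omega$ is identified with $\{0,\dots,n-1\}$. For $A\subseteq\omega$, $d_n(A)=|A\cap n|/n$, $\underline d(A)=\liminf_n d_n(A)$, $\overline d(A)=\limsup_n d_n(A)$; if they are equal the common value $d(A)$ is the asymptotic density of $A$, otherwise $A$ does not have asymptotic density. $\mathrm{Sym}(\omega)$ is the set of permutations of $\omega$. $D$ is the collection of infinite-coinfinite subsets of $\omega$ having asymptotic density. For $x\in D$, $\pi\in\mathrm{Sym}(\omega)$, $x\,R\,\pi$ means $d(\pi[x])\ne d(x)$, where the case that $d(\pi[x])$ is undefined is also allowed (counts as $\neq$).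 Slaloms: for $h\in\omega^\omega$ with $h(n)\ge1$ for all $n$, $\Phi_h$ is the set of $h$-slaloms, i.e. functions $\phi:\omega\to[\omega]^{<\omega}$ with $|\phi(n)|\le h(n)$ for all $n$. For $f\in\omega^\omega$ and $\phi\in\Phi_h$, $f\in^\infty\phi$ means $f(n)\in\phi(n)$ for infinitely many $n$. $\mathcal M$ is the ideal of meager subsets of $2^\omega$; in $(\mathcal M,2^\omega,\not\ni)$, $M\in\mathcal M$ is related to $x\in2^\omega$ iff $x\notin M$. *)

(* Defs.v *)
From mathcomp Require Import all_boot all_order all_algebra finmap.
From mathcomp Require Import all_classical all_reals all_analysis.
From mathcomp Require Import zify lra.
Import Order.TTheory GRing.Theory Num.Theory.
Import numFieldNormedType.Exports.

Set Implicit Arguments.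
Unset Strict Implicit.
Unset Printing Implicit Defensive.

Local Open Scope classical_set_scope.
Local Open Scope ring_scope.

Record relsys := RelSys {
  rs_neg : Type;
  rs_pos : Type;
  rs_rel : rs_neg -> rs_pos -> Prop;
  rs_dominated : forall a, exists b, rs_rel a b;
  rs_unbounded : forall b, exists a, ~ rs_rel a b }.

Definition tukey_le (A B : relsys) : Prop :=
  exists (phin : rs_neg A -> rs_neg B) (phip : rs_pos B -> rs_pos A),
    forall a b, rs_rel (phin a) b -> rs_rel a (phip b).

Definition count_below (A : set nat) (n : nat) : nat :=
  #|[set i : 'I_n | (i : nat) \in A]%SET|.

Section Density.
Variable R : realType.
Implicit Type A : set nat.

(* The value at n = 0 is 0 / 0 = 0, which does not affect limits. *)
Definition rel_density A : R^nat := fun n => (count_below A n)%:R / n%:R.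

(* [limn_inf] and [limn_sup] are total; as [rel_density A] takes values in
   [0, 1], they are the genuine liminf and limsup here. *)
Definition lower_density A : R := limn_inf (rel_density A).
Definition upper_density A : R := limn_sup (rel_density A).

Definition has_density A : Prop := lower_density A = upper_density A.

(* Meaningful only when [has_density A]. *)
Definition density A : R := lower_density A.

Definition in_D A : Prop :=
  [/\ infinite_set A, infinite_set (~` A) & has_density A].

Definition setsD := {x : set nat | in_D x}.

Definition symN := {p : nat -> nat | bijective p}.

Definition density_rel (x : setsD) (p : symN) : Prop :=
  ~ (has_density (sval p @` sval x) /\
     density (sval p @` sval x) = density (sval x)).

End Density.

Definition slalom (h : nat -> nat) :=
  {phi : nat -> {fset nat} | forall n, (#|` phi n| <= h n)%N}.

Definition inf_captured (h : nat -> nat) (f : nat -> nat) (phi : slalom h) :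
  Prop := infinite_set [set n | f n \in sval phi n].

Section Meager.
Variable T : topologicalType.
Implicit Type A : set T.

Definition nowhere_dense A : Prop := (closure A)° = set0.

Definition meager A : Prop :=
  exists F : (set T)^nat,
    (forall n, nowhere_dense (F n)) /\ A = \bigcup_n F n.

End Meager.

Definition meager_ideal := {M : set cantor_space | meager M}.

Definition not_in_rel (M : meager_ideal) (x : cantor_space) : Prop :=
  ~ sval M x.

Section SlalomSystem.
Variable h : nat -> nat.

Lemma inf_captured_dominated (h_ge1 : forall n, (1 <= h n)%N)
    (f : nat -> nat) :
  exists phi : slalom h, inf_captured f phi.
Proof.
have H n : (#|` [fset f n]%fset | <= h n)%N by rewrite cardfs1.
exists (exist _ (fun n => [fset f n]%fset) H); rewrite /inf_captured /=.
suff -> : [set n | f n \in [fset f n]%fset] = setT by exact: infinite_nat.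
by apply/seteqP; split => // n _ /=; rewrite inE.
Qed.

Lemma inf_captured_unbounded (phi : slalom h) :
  exists f : nat -> nat, ~ inf_captured f phi.
Proof.
exists (fun n => (\max_(i <- enum_fset (sval phi n)) i).+1) => /infinite_setN0.
move=> [n /= Hn].
by have := @leq_bigmax_seq _ (enum_fset (sval phi n)) xpredT id _ Hn isT; rewrite ltnn.
Qed.

End SlalomSystem.

Section MeagerSystem.

Lemma not_in_unbounded (x : cantor_space) :
  exists M : meager_ideal, ~ not_in_rel M x.
Proof.
suff Hm : meager [set x].
  by exists (exist _ [set x] Hm); rewrite /not_in_rel /=; apply.
exists (fun=> [set x]); split; last first.
  by apply/seteqP; split => [y -> | y [n _ ->]] //; exists 0%N.
move=> _; rewrite /nowhere_dense.
have <- : [set x] = closure [set x].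
  apply/closure_id; apply: (@accessible_closed_set1 cantor_space).
  by apply: hausdorff_accessible; exact: cantor_space_hausdorff.
apply/seteqP; split => // y xy.
have yx : y = x := interior_subset xy.
have [_ lp] := cantor_perfect.
have : limit_point [set: cantor_space] y by rewrite lp.
by move=> /(_ _ xy) [z [/eqP zy _ zx]]; apply: zy; rewrite yx.
Qed.

Lemma not_in_dominated (M : meager_ideal) :
  exists x : cantor_space, not_in_rel M x.
Proof.
case: M => M [F [ndF MF]]; rewrite /not_in_rel /=.
have step n (U : set cantor_space) : open U -> U !=set0 ->
    exists V : set cantor_space,
      [/\ open V, V !=set0 & closure V `<=` U `&` ~` closure (F n)].
  move=> oU [u Uu].
  have [v [Uv nFv]] : U `&` ~` closure (F n) !=set0.
    apply: contrapT => /set0P/negP/negPn/eqP UF.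
    have : (closure (F n))° u.
      apply: (filterS _ (open_nbhs_nbhs (conj oU Uu))) => w Uw.
      by apply: contrapT => nw; rewrite -[False]/((set0 : set cantor_space) w) -UF.
    by rewrite (ndF n).
  have : nbhs v (U `&` ~` closure (F n)).
    apply: open_nbhs_nbhs; split => //; apply: openI => //.
    by apply: closed_openC; exact: closed_closure.
  move=> /(compact_regular cantor_space_hausdorff cantor_space_compact (x := v) filterT).
  move=> [W Wv WU]; exists (W°); split.
  - exact: open_interior.
  - by exists v.
  - apply: subset_trans WU; apply: closure_subset; exact: interior_subset.
pose NE := {U : set cantor_space | open U /\ U !=set0}.
have stepNE n (U : NE) : exists V : NE,
    closure (sval V) `<=` sval U `&` ~` closure (F n).
  case: U => U [oU U0]; have [V [oV V0 HV]] := step n U oU U0.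
  by exists (exist _ V (conj oV V0)).
have [nxt Hnxt] : {nxt : nat -> NE -> NE | forall n U,
    closure (sval (nxt n U)) `<=` sval U `&` ~` closure (F n)}.
  by exists (fun n U => sval (cid (stepNE n U))) => n U; exact: (svalP (cid (stepNE n U))).
have TNE : open [set: cantor_space] /\ [set: cantor_space] !=set0.
  by split; [exact: openT | exists point].
pose U_ := fix U_ n : NE := if n is m.+1 then nxt m (U_ m) else exist _ _ TNE.
have Umono m n : (m <= n)%N -> sval (U_ n) `<=` sval (U_ m).
  elim: n => [|n IH]; first by rewrite leqn0 => /eqP ->.
  rewrite leq_eqVlt => /orP[/eqP -> //|]; rewrite ltnS => /IH.
  apply: subset_trans => /= y Uy.
  by have [] := @Hnxt n (U_ n) y (subset_closure Uy).
have [p Hp] : {p : nat -> cantor_space | forall n, sval (U_ n) (p n)}.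
  have H n : exists y, sval (U_ n) y by have [_ [y ?]] := svalP (U_ n); exists y.
  by exists (fun n => sval (cid (H n))) => n; exact: (svalP (cid (H n))).
have [x [_ Hx]] : [set: cantor_space] `&` cluster (p @ \oo) !=set0.
  by apply: cantor_space_compact; exact: filterT.
exists x; rewrite MF => -[n _ Fx].
have [_ +] : (sval (U_ n) `&` ~` closure (F n)) x.
  apply: (@Hnxt n (U_ n)) => B Bx.
  rewrite -[nxt n (U_ n)]/(U_ n.+1).
  apply: Hx => //.
  exists n.+1 => // k /= nk; exact: (Umono n.+1 k nk _ (Hp k)).
by apply; exact: subset_closure.
Qed.

End MeagerSystem.

Section DensitySystem.
Variable R : realType.
Implicit Type A : set nat.

Lemma count_belowC A n : (count_below A n + count_below (~` A) n = n)%N.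
Proof.
rewrite /count_below -[RHS]card_ord -(cardsC [set i : 'I_n | (i : nat) \in A]%SET).
congr (_ + _)%N; apply: eq_card => i; rewrite !inE.
by apply/idP/idP; [rewrite in_setC|rewrite in_setC].
Qed.

Lemma finite_bounded A : finite_set A ->
  exists N, forall k, A k -> (k < N)%N.
Proof.
move=> /finite_seqP[s ->]; exists (\max_(i <- s) i).+1 => k /= ks.
by rewrite ltnS (@leq_bigmax_seq _ s xpredT id).
Qed.

Lemma count_below_le A n m (k : nat -> nat) :
  (forall i, (i < n)%N -> A i -> (k i < m)%N) ->
  (forall i j, A i -> A j -> k i = k j -> i = j) ->
  (count_below A n <= m)%N.
Proof.
case: m => [|m] kb kI.
  rewrite leqn0 /count_below cards_eq0; apply/eqP/setP => i; rewrite !inE.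
  by apply/negbTE/negP => /set_mem /(kb _ (ltn_ord i)).
rewrite /count_below -[leqRHS]card_ord.
rewrite -(@card_in_imset _ _ (fun i : 'I_n => inord (k i) : 'I_m.+1)).
  exact: max_card.
move=> i j; rewrite !finset.in_set => /set_mem Hi /set_mem Hj /(congr1 val) /=.
rewrite !inordK; [|exact: kb..] => kk.
by apply: val_inj; exact: kI.
Qed.

Lemma sparse_count (a : nat -> nat) : (forall k, k * k <= a k)%N ->
  forall n, (count_below (range a) n * count_below (range a) n <= 4 * n)%N.
Proof.
move=> Ha n.
have Hm m : (n <= m * m)%N -> (count_below (range a) n <= m)%N.
  move=> nm.
  have /choice[k_ kP] : forall i : nat, exists k, range a i -> a k = i.
    move=> i; have [[k _ aki]|ni] := pselect (range a i); first by exists k.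
    by exists 0%N.
  apply: (@count_below_le _ _ _ k_) => [i ni Hi|i j Hi Hj kk].
    have := Ha (k_ i); rewrite (kP _ Hi) => H.
    have im := leq_trans ni nm.
    by rewrite ltnNge; apply/negP => mk; have := leq_mul mk mk; lia.
  by rewrite -(kP _ Hi) -(kP _ Hj) kk.
have exm : exists m, (n <= m * m)%N.
  by exists n; case: (n) => // p; rewrite leq_pmull.
case: (ex_minnP exm) => -[|m] nm mmin.
  by have := Hm _ nm; rewrite leqn0 => /eqP ->.
have c1 := Hm _ nm.
have c2 : (m * m < n)%N.
  by rewrite ltnNge; apply/negP => /mmin; rewrite ltnn.
apply: leq_trans (leq_mul c1 c1) _.
have mm : (m <= m * m)%N by case: (m) => // p; rewrite leq_pmull.
by rewrite mulSn mulnS; move: c2 mm; set q := (m * m)%N; lia.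
Qed.

Lemma sparse_infinite (a : nat -> nat) : (forall k, k * k <= a k)%N ->
  infinite_set (range a).
Proof.
move=> Ha /finite_bounded[N HN].
have : (a N < N)%N by apply: HN; exists N.
have : (N <= N * N)%N by case: (N) => // p; rewrite leq_pmull.
by have := Ha N; lia.
Qed.

Lemma sparse_coinfinite (a : nat -> nat) : (forall k, k * k <= a k)%N ->
  infinite_set (~` range a).
Proof.
move=> Ha /finite_bounded[N HN].
pose t := (4 * N + 8)%N; pose n := (N + t)%N.
have HC : (count_below (~` range a) n <= N)%N.
  by apply: (@count_below_le _ _ _ id) => // i _ /HN.
have := count_belowC (range a) n; have := sparse_count Ha n.
move: HC; set c := count_below (range a) n => HC cn Hn.
have tc : (t <= c)%N by move: HC Hn; rewrite /n; lia.
have := leq_trans (leq_mul tc tc) cn; rewrite /n /t.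
rewrite mulnDl !mulnDr; set q := (4 * N * (4 * N))%N; lia.
Qed.

Lemma rel_densityC A l : rel_density R A @ \oo --> l ->
  rel_density R (~` A) @ \oo --> 1 - l.
Proof.
move=> Al; have H : (fun n => 1 - rel_density R A n) @ \oo --> 1 - l.
  by apply: cvgB => //; exact: cvg_cst.
apply: cvg_trans H; apply: near_eq_cvg; near=> n.
have n0 : (0 < n)%N by near: n; exact: nbhs_infty_gt.
have nR : (n%:R : R) != 0 by rewrite pnatr_eq0 -lt0n.
apply: (mulIf nR); rewrite mulrBl !mulfVK// mul1r.
by rewrite -{1}(count_belowC A n) natrD addrAC subrr add0r.
Unshelve. all: by end_near. Qed.

Lemma cvg_has_density A l : rel_density R A @ \oo --> l ->
  has_density R A /\ density R A = l.
Proof.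
by move=> /cvg_limn_inf_sup[il sl]; rewrite /has_density /density
  /lower_density /upper_density il sl.
Qed.

Lemma sparse_cvg (a : nat -> nat) : (forall k, k * k <= a k)%N ->
  rel_density R (range a) @ \oo --> (0 : R).
Proof.
move=> Ha; apply/cvgrPdist_le => e e0; near=> n.
have n0 : (0 < n)%N by near: n; exact: nbhs_infty_gt.
have nR : 0 < (n%:R : R) by rewrite ltr0n.
rewrite sub0r normrN ger0_norm; last by rewrite divr_ge0.
rewrite ler_pdivrMr// -ler_sqr ?nnegrE ?mulr_ge0 ?(ltW e0)//.
have := sparse_count Ha n; rewrite -(ler_nat R) !natrM -expr2 => /le_trans; apply.
rewrite exprMn (expr2 n%:R) mulrA ler_wpM2r//.
rewrite -ler_pdivrMl ?exprn_gt0//.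
by near: n; exact: nbhs_infty_ger.
Unshelve. all: by end_near. Qed.

Lemma bij_of_infinite A (B : set nat) :
  infinite_set A -> infinite_set (~` A) ->
  infinite_set B -> infinite_set (~` B) ->
  exists2 p : nat -> nat, bijective p & p @` A = B.
Proof.
have eqn (X Y : set nat) : infinite_set X -> infinite_set Y ->
    exists f : nat -> nat, set_bij X Y f.
  move=> Xi Yi; apply/card_set_bijP.
  have XN : (X #= [set: nat])%card by exact: (eq_card_nat (countableP X) Xi).
  have YN : (Y #= [set: nat])%card by exact: (eq_card_nat (countableP Y) Yi).
  by rewrite (card_eql XN) card_eq_sym.
move=> Ai Ci Bi Di.
have [f [fs fI fS]] := eqn _ _ Ai Bi; have [g [gs gI gS]] := eqn _ _ Ci Di.
pose p x := if x \in A then f x else g x.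
have pA x : A x -> p x = f x by move=> Ax; rewrite /p mem_set.
have pC x : ~ A x -> p x = g x by move=> Ax; rewrite /p memNset.
have fB x : A x -> B (f x) by exact: fs.
have gB x : ~ A x -> ~ B (g x) by exact: gs.
exists p.
  rewrite -setTT_bijective; split => //.
    move=> x y _ _.
    have [Ax|Ax] := pselect (A x); have [Ay|Ay] := pselect (A y).
    - by rewrite !pA//; apply: fI; rewrite inE.
    - by rewrite pA// pC// => E; case: (gB y Ay); rewrite -E; exact: fB.
    - by rewrite pC// pA// => E; case: (gB x Ax); rewrite E; exact: fB.
    - by rewrite !pC//; apply: gI; rewrite inE.
  move=> y _; have [/fS[x Ax <-]|/gS[x Ax <-]] := pselect (B y).
    by exists x => //; exact: pA.
  by exists x => //; exact: pC.
apply/seteqP; split => [_ [x Ax <-]|y /fS[x Ax <-]].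
  by rewrite pA//; exact: fB.
by exists x => //; exact: pA.
Qed.

Lemma density_rel_dominated (x : setsD R) : exists p : symN, density_rel x p.
Proof.
case: x => x Dx; have [xi xc xd] := Dx.
pose a k := (k * k)%N; have Ha k : (k * k <= a k)%N by [].
have ai := sparse_infinite Ha; have ac := sparse_coinfinite Ha.
have [d0|dn0] := eqVneq (density R x) 0.
  have [|p pb px] := @bij_of_infinite x (~` range a) xi xc ac.
    by rewrite setCK.
  exists (exist _ p pb); rewrite /density_rel /= px d0 => -[_].
  have [_ ->] := cvg_has_density (rel_densityC (sparse_cvg Ha)).
  by rewrite subr0; apply/eqP; exact: oner_neq0.
have [p pb px] := bij_of_infinite xi xc ai ac.
exists (exist _ p pb); rewrite /density_rel /= px => -[_].
have [_ ->] := cvg_has_density (sparse_cvg Ha).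
by apply/eqP; rewrite eq_sym.
Qed.

Lemma density_rel_unbounded (p : symN) : exists x : setsD R, ~ density_rel x p.
Proof.
case: p => p pb.
have /choice[a Ha] : forall k, exists m, (k * k <= m)%N /\ (k * k <= p m)%N.
  move=> k; have /finite_bounded[N HN] : finite_set (p @^-1` `I_(k * k)).
    by apply: finite_preimage => // i j _ _; exact: bij_inj.
  exists (maxn N (k * k)); split; first exact: leq_maxr.
  rewrite leqNgt; apply/negP => /HN; rewrite ltnNge leq_maxl//.
have Ha1 k : (k * k <= a k)%N by have [] := Ha k.
have Ha2 k : (k * k <= (p \o a) k)%N by have [] := Ha k.
have [h1 d1] := cvg_has_density (sparse_cvg Ha1).
have [h2 d2] := cvg_has_density (sparse_cvg Ha2).
have Da : in_D R (range a).
  by split => //; [exact: sparse_infinite|exact: sparse_coinfinite].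
exists (exist _ (range a) Da); rewrite /density_rel /=; apply.
by rewrite image_comp d1 d2.
Qed.

End DensitySystem.

Definition slalom_sys (h : nat -> nat) (h_ge1 : forall n, (1 <= h n)%N) :
    relsys :=
  RelSys (@inf_captured_dominated h h_ge1) (@inf_captured_unbounded h).

Definition density_sys (R : realType) : relsys :=
  RelSys (@density_rel_dominated R) (@density_rel_unbounded R).

Definition meager_sys : relsys :=
  RelSys not_in_dominated not_in_unbounded.

(* Main.v *)
Require Import Defs.
From mathcomp Require Import all_boot all_order all_algebra finmap.
From mathcomp Require Import all_classical all_reals all_analysis.
From mathcomp Require Import zify lra.
Import Order.TTheory GRing.Theory Num.Theory.
Import numFieldNormedType.Exports.

(** Both reductions rest on the freedom of a permutation to move single points
    arbitrarily far, so that only the order of appearance of the points of a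
    set decides its density.

    Lower bound.  A function [f] is sent to the set of the numbers
    [n * n + f n].  It is at least as sparse as the squares, so it has density
    [0].  If a permutation [p] changes this density, then [p] cannot send
    almost every [n * n + f n] to a value that is at least [n * n], since the
    image would then be as sparse as the squares up to a finite set
    ([eventually_sparse_cvg]).  Hence for infinitely many [n] the number
    [n * n + f n] is among the at most [n * n] numbers that [p] sends below
    [n * n].  Those numbers, shifted down by [n * n], form the value at [n] of
    a slalom that depends on [p] only and captures [f] infinitely often; this
    is why [h0 n = n * n] is large enough.

    Upper bound.  A Cohen generic permutation destroys the density of every
    given set [x] that is infinite and coinfinite.  A point [y] of the Cantor
    space is read bit by bit as a sequence of finite injective lists, each
    extending the previous one and each enumerating an initial segment of the
    natural numbers.  If their lengths are unbounded, they define a bijection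
    [q] ([coded_bijection]), and [y] is sent to its inverse, so that the image
    of [x] is the preimage of [x] under [q].  Any finite list can be continued
    with as many members of a given infinite set as desired, so it has
    an extension with an arbitrarily long initial segment of which at least two
    thirds belong to [x], and another one of which at least two thirds belong
    to the complement ([crowds_dense]).  So outside a meager
    set of [y], which depends on [x] only, the image of [x] has lower density
    at most [1/3] and upper density at least [2/3] ([no_density]), hence no
    density. *)

Set Implicit Arguments.
Unset Strict Implicit.
Unset Printing Implicit Defensive.

Local Open Scope classical_set_scope.
Local Open Scope ring_scope.

(** * Counting below a bound and density *)

Lemma count_below_subU (A B : set nat) N n : A `<=` B `|` `I_N ->
  (count_below A n <= count_below B n + N)%N.
Proof.
move=> AB.
pose S (X : set nat) : {set 'I_n} := [set i : 'I_n | (i : nat) \in X]%SET.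
have cI : (#|S `I_N| <= N)%N by apply: (@count_below_le _ n N id).
apply: leq_trans (leq_add (leqnn #|S B|) cI); apply: leq_trans (leq_card_setU _ _).
apply/subset_leq_card/fintype.subsetP => i; rewrite !finset.inE => /set_mem/AB[Bi|Ni].
- by rewrite mem_set.
- by rewrite orbC mem_set.
Qed.

(** The numbers below [m] that are outside [A] are all below [N]. *)
Lemma count_below_missing (A : set nat) N m :
  (forall i, (N <= i < m)%N -> A i) -> (m <= count_below A m + N)%N.
Proof.
move=> HA; rewrite -{1}(count_belowC A m) leq_add2l.
apply: (@count_below_le _ m N id) => // i im nAi.
by rewrite ltnNge; apply/negP => Ni; apply: nAi; apply: HA; rewrite Ni.
Qed.

Section DensityFacts.
Variable R : realType.
Implicit Type A : set nat.

Lemma rel_density_ge0 A n : 0 <= rel_density R A n.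
Proof. by rewrite divr_ge0. Qed.

Lemma rel_density_le1 A n : rel_density R A n <= 1.
Proof.
rewrite /rel_density; case: n => [|n]; first by rewrite invr0 mulr0.
rewrite ler_pdivrMr ?ltr0n// mul1r ler_nat -[leqRHS](count_belowC A).
exact: leq_addr.
Qed.

Lemma bounded_rel_density A : bounded_fun (rel_density R A).
Proof.
exists 1; split=> // M M1 n _ /=.
by rewrite ger0_norm ?rel_density_ge0// (le_trans (rel_density_le1 _ _))// ltW.
Qed.

Lemma limn_inf_le_frequently (u : R^nat) c : bounded_fun u ->
  (forall n, exists2 m, (n <= m)%N & u m <= c) -> limn_inf u <= c.
Proof.
move=> bu uc; rewrite limn_infE//; apply: ge_sup; first by exists (infs u 0%N), 0%N.
move=> _ [n _ <-]; have [m nm umc] := uc n.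
apply: le_trans umc; rewrite /infs /=; apply: ge_inf; last by exists m.
have [l lu] := bounded_fun_has_lbound bu.
by exists l => _ [k _ <-]; apply: lu; exists k.
Qed.

Lemma limn_sup_ge_frequently (u : R^nat) c : bounded_fun u ->
  (forall n, exists2 m, (n <= m)%N & c <= u m) -> c <= limn_sup u.
Proof.
move=> bu uc; rewrite limn_supE//; apply: lb_le_inf; first by exists (sups u 0%N), 0%N.
move=> _ [n _ <-]; have [m nm umc] := uc n.
apply: le_trans umc _; rewrite /sups /=; apply: ub_le_sup; last by exists m.
have [l lu] := bounded_fun_has_ubound bu.
by exists l => _ [k _ <-]; apply: lu; exists k.
Qed.

(** Any fraction above one half would do: a set that fills it infinitely often
    and whose complement does so too has no density. *)
Definition often_two_thirds A :=
  forall k, exists2 m, (k < m)%N & (2 * m <= 3 * count_below A m)%N.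

(** The second hypothesis says that the set itself fills at most one third of
    infinitely many initial segments. *)
Lemma no_density A : often_two_thirds A -> often_two_thirds (~` A) ->
  ~ has_density R A.
Proof.
move=> HA HC; rewrite /has_density => E.
have lo : lower_density R A <= 1 / 3.
  apply: limn_inf_le_frequently; first exact: bounded_rel_density.
  move=> n; have [m nm Hm] := HC n; exists m; first exact: ltnW.
  have m0 : (0 < m)%N by apply: leq_ltn_trans nm.
  rewrite ler_pdivrMr ?ltr0n//.
  have : (3 * count_below A m <= m)%N by have := count_belowC A m; lia.
  rewrite -(ler_nat R) natrM; lra.
have up : 2 / 3 <= upper_density R A.
  apply: limn_sup_ge_frequently; first exact: bounded_rel_density.
  move=> n; have [m nm Hm] := HA n; exists m; first exact: ltnW.
  have m0 : (0 < m)%N by apply: leq_ltn_trans nm.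
  rewrite ler_pdivlMr ?ltr0n//.
  by move: Hm; rewrite -(ler_nat R) !natrM; lra.
by move: up; rewrite -E => up; have := le_trans up lo; lra.
Qed.

(** The finitely many terms that may be below the squares contribute a bounded
    number of elements, which is negligible after division by [n]. *)
Lemma eventually_sparse_cvg (c : nat -> nat) N :
  (forall k, (N <= k)%N -> (k * k <= c k)%N) ->
  rel_density R (range c) @ \oo --> (0 : R).
Proof.
move=> Hc; pose c' k := maxn (c k) (k * k).
have Hc' k : (k * k <= c' k)%N by exact: leq_maxr.
pose K := (\max_(i < N) c i).+1.
have sub : range c `<=` range c' `|` `I_K.
  move=> _ [k _ <-]; have [kN|Nk] := ltnP k N.
    by right; rewrite /= ltnS (@leq_bigmax _ (fun i : 'I_N => c i) (Ordinal kN)).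
  by left; exists k => //; apply/maxn_idPl; exact: Hc.
have bnd n : 0 <= rel_density R (range c) n <=
    rel_density R (range c') n + K%:R * n%:R^-1.
  rewrite rel_density_ge0 /= /rel_density -mulrDl ler_wpM2r ?invr_ge0//.
  by rewrite -natrD ler_nat count_below_subU.
have bnd' : \forall n \near \oo, 0 <= rel_density R (range c) n <=
    rel_density R (range c') n + K%:R * n%:R^-1 by exact: nearW.
apply: (squeeze_cvgr bnd'); first exact: cvg_cst.
rewrite -[X in _ --> X]addr0; apply: cvgD; first exact: sparse_cvg.
rewrite -[X in _ --> X](mulr0 K%:R); apply: cvgMr.
by apply/gtr0_cvgV0; [near=> n; rewrite ltr0n; near: n; exact: nbhs_infty_gt
                     |exact: cvgr_idn].
Unshelve. all: by end_near. Qed.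

End DensityFacts.

(** * Slaloms are reducible to densities of permuted sets *)

Section SlalomBelowDensity.
Variable R : realType.

(** The summand [n * n] makes the range sparse whatever [f] is, and knowing [n]
    suffices to recover [f n]. *)
Definition code (f : nat -> nat) (n : nat) := (n * n + f n)%N.

Lemma code_ge f n : (n * n <= code f n)%N. Proof. exact: leq_addr. Qed.

Lemma code_in_D f : in_D R (range (code f)).
Proof.
have [? _] := cvg_has_density (sparse_cvg (R := R) (code_ge f)).
by split=> //; [exact: sparse_infinite (code_ge f)|exact: sparse_coinfinite (code_ge f)].
Qed.

(** Injectivity of the permutation bounds by [n * n] the number of arguments
    with a value below [n * n]. *)
Lemma small_value_slalom (h : nat -> nat) (p : symN) :
  (forall n, (n * n <= h n)%N) ->
  exists phi : slalom h, forall n i,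
    (sval p i < n * n)%N -> (i - n * n)%N \in sval phi n.
Proof.
case: p => p pb hn /=; have [g pg _] := pb.
pose phi n := [fset x in [seq (g j - n * n)%N | j <- iota 0 (n * n)]]%fset.
have sphi n : (#|` phi n| <= h n)%N.
  apply: leq_trans (hn n); rewrite card_fseq.
  by apply: leq_trans (size_undup _) _; rewrite size_map size_iota.
exists (exist _ phi sphi) => n i pin /=; rewrite /phi !inE.
by apply/mapP; exists (p i); rewrite ?mem_iota// pg.
Qed.

Theorem slalom_le_density (h : nat -> nat) (h_ge1 : forall n, (1 <= h n)%N) :
  (forall n, (n * n <= h n)%N) -> tukey_le (slalom_sys h_ge1) (density_sys R).
Proof.
move=> hn; have [phip Hphi] := choice (fun p => small_value_slalom p hn).
exists (fun f => exist _ (range (code f)) (code_in_D f)), phip => f p /=.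
rewrite /density_rel /inf_captured /=; apply: contra_notP => /contrapT fin.
have [N HN] := finite_bounded fin.
have big k : (N <= k)%N -> (k * k <= (sval p \o code f) k)%N.
  move=> Nk /=; rewrite leqNgt; apply/negP => /Hphi; rewrite /code addKn.
  by move=> /HN; rewrite ltnNge Nk.
have [h1 d1] := cvg_has_density (eventually_sparse_cvg (R := R) big).
have [_ d2] := cvg_has_density (sparse_cvg (R := R) (code_ge f)).
by rewrite image_comp d1 d2.
Qed.

End SlalomBelowDensity.

(** * Category in the Cantor space by finite approximations *)

Lemma nbhs_agree (y : cantor_space) n :
  nbhs y [set z : cantor_space | forall i, (i < n)%N -> z i = y i].
Proof.
elim: n => [|n IH]; first by apply: filterS filterT.
have H : nbhs y (@proj _ (fun=> bool) n @^-1` [set y n]).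
  exact: (@proj_continuous nat (fun=> bool) n y _ (discrete_set1 _)).
apply: filterS (filterI IH H) => z [zn zy] i.
by rewrite ltnS leq_eqVlt => /orP[/eqP -> //|]; exact: zn.
Qed.

(** Otherwise points outside [U] agreeing with [y] on longer and longer initial
    segments would converge to [y] pointwise, that is, in the product
    topology. *)
Lemma nbhs_agreeP (y : cantor_space) (U : set cantor_space) : nbhs y U ->
  exists n, forall z : cantor_space, (forall i, (i < n)%N -> z i = y i) -> U z.
Proof.
move=> Uy; apply: contrapT => /forallNP H.
have /choice[z Hz] : forall n, exists z : cantor_space,
    (forall i, (i < n)%N -> z i = y i) /\ ~ U z.
  by move=> n; have /existsNP[z /not_implyP[]] := H n; exists z.
have : z @ \oo --> y.
  apply/cvg_sup => i V [_ [[W oW <-] Wyi WV]].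
  apply: (filterS WV); exists i.+1 => // n /= ni.
  by have [-> //] := Hz n.
move=> /(_ U Uy) [n _ /(_ n (leqnn n)) Uzn].
by have [_] := Hz n; exact.
Qed.

(** A neighbourhood contains all points with some prefix; among them, those whose
    prefix is continued into [G] form a neighbourhood disjoint from the set. *)
Lemma nowhere_dense_avoiding (G : seq bool -> Prop) :
  (forall s, exists t, G (s ++ t)) ->
  nowhere_dense [set y : cantor_space | forall n, ~ G (mkseq y n)].
Proof.
move=> Gd; rewrite /nowhere_dense; apply/seteqP; split=> // y /nbhs_agreeP[n Hn].
have [t Gt] := Gd (mkseq y n).
(* The point that continues the prefix and [t] with zeros. *)
pose z : cantor_space := nth false (mkseq y n ++ t).
have zn i : (i < n)%N -> z i = y i.
  by move=> ni; rewrite /z nth_cat size_mkseq ni nth_mkseq.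
have [w [Fw wz]] := Hn z zn _ (nbhs_agree z (size (mkseq y n ++ t))).
apply: (Fw (size (mkseq y n ++ t))).
rewrite (_ : mkseq w _ = mkseq y n ++ t)//.
apply: (@eq_from_nth _ false); rewrite size_mkseq// => i ist.
by rewrite nth_mkseq// wz.
Qed.

(** * Reading a permutation from a binary sequence *)

Definition iota_perm (l : seq nat) := perm_eq l (iota 0 (size l)).

(** The enumeration of all finite lists by which a run of [n] ones is read. *)
Definition word (n : nat) : seq nat := odflt [::] (choice.unpickle n).
Arguments word : simpl never.

Lemma wordK (l : seq nat) : word (choice.pickle l) = l.
Proof. by rewrite /word choice.pickleK. Qed.

(** The state consists of the list coded so far and of the number of ones since
    the last zero.  A zero ends the run: the list that it codes replaces the
    current one when it is a legitimate extension, and is ignored otherwise, so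
    that every binary sequence can be read. *)
Definition read_bit (st : seq nat * nat) (b : bool) : seq nat * nat :=
  if b then (st.1, st.2.+1) else
  (if iota_perm (word st.2) && prefix st.1 (word st.2) then word st.2 else st.1,
   0%N).

Definition read (s : seq bool) := foldl read_bit ([::], 0%N) s.

Definition coded (s : seq bool) : seq nat := (read s).1.

Lemma coded_iota_perm s : iota_perm (coded s).
Proof.
rewrite /coded; elim/last_ind: s => [|s b IH]//.
rewrite /read foldl_rcons -/(read s) /read_bit; case: b => //=.
by case: ifP => // /andP[].
Qed.

Lemma coded_prefix s t : prefix (coded s) (coded (s ++ t)).
Proof.
elim/last_ind: t => [|t b IH]; first by rewrite cats0 prefix_refl.
apply: prefix_trans IH _; rewrite -rcons_cat /coded /read foldl_rcons.
rewrite -/(read (s ++ t)) /read_bit; case: b => /=; first exact: prefix_refl.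
by case: ifP => [/andP[]//|_]; exact: prefix_refl.
Qed.

(** The zero first appended ends a run possibly left unfinished by [s]; ending
    this run can lengthen the coded list, hence the form of the hypothesis. *)
Lemma coded_reach s l : iota_perm l -> prefix (coded (rcons s false)) l ->
  exists t, coded (s ++ t) = l.
Proof.
move=> pl sl; exists (false :: rcons (nseq (choice.pickle l) true) false).
rewrite -cat_rcons -rcons_cat /coded /read foldl_rcons foldl_cat -/(read _).
have [l0 E] : exists l0, read (rcons s false) = (l0, 0%N).
  by rewrite /read foldl_rcons /read_bit; eexists.
have count_ones n c : foldl read_bit (l0, c) (nseq n true) = (l0, (n + c)%N).
  by elim: n c => //= n IH c; rewrite IH addnS.
by move: sl; rewrite /coded E count_ones /read_bit /= addn0 wordK pl => ->.
Qed.

Definition agrees (q : nat -> nat) (l : seq nat) :=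
  forall i, (i < size l)%N -> nth 0%N l i = q i.

(** The coded lists form a chain, so their union is a function.  It is injective
    since each list is duplicate-free, and surjective since a list of length
    greater than [k] contains [k]. *)
Lemma coded_bijection (y : cantor_space) :
  (forall k, exists n, (k < size (coded (mkseq y n)))%N) ->
  exists2 q : nat -> nat, bijective q &
    forall n, agrees q (coded (mkseq y n)).
Proof.
move=> /choice[M HM]; pose c n := coded (mkseq y n).
have cle m n : (m <= n)%N -> prefix (c m) (c n).
  move=> mn; rewrite /c (_ : mkseq y n = mkseq y m ++ map y (iota m (n - m))).
    exact: coded_prefix.
  by rewrite /mkseq -map_cat -{2}(add0n m) -iotaD subnKC.
have nth_c m n i : (m <= n)%N -> (i < size (c m))%N ->
    nth 0%N (c m) i = nth 0%N (c n) i.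
  by move=> /cle/prefixP[t ->] im; rewrite nth_cat im.
pose q i := nth 0%N (c (M i)) i.
have qc n i : (i < size (c n))%N -> nth 0%N (c n) i = q i.
  move=> im; have [Mn|/ltnW nM] := leqP (M i) n; last exact: nth_c.
  by rewrite /q (nth_c _ _ _ Mn)// HM.
exists q => //; rewrite -setTT_bijective; split=> //.
  move=> i j _ _.
  pose m := maxn (M i) (M j).
  have im : (i < size (c m))%N.
    by apply: leq_trans (HM i) (size_prefix (cle _ _ _)); exact: leq_maxl.
  have jm : (j < size (c m))%N.
    by apply: leq_trans (HM j) (size_prefix (cle _ _ _)); exact: leq_maxr.
  rewrite -(qc _ _ im) -(qc _ _ jm) => /eqP.
  rewrite nth_uniq//; first by move/eqP.
  by rewrite (perm_uniq (coded_iota_perm _)) iota_uniq.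
move=> k _.
have : k \in c (M k).
  by rewrite (perm_mem (coded_iota_perm _)) mem_iota /= add0n HM.
move=> /(nthP 0%N)[i im <-]; exists i => //.
by rewrite qc.
Qed.

(** The list coded by [s] forces the preimage of [A] under the coded bijection to
    fill two thirds of some initial segment of length beyond [k].  Comparing
    with the size of the list is what makes the coded lists of a generic
    sequence unbounded. *)
Definition crowds (A : set nat) (k : nat) (s : seq bool) : Prop :=
  exists2 m, (k < m <= size (coded s))%N &
    forall q, agrees q (coded s) -> (2 * m <= 3 * count_below (q @^-1` A) m)%N.

(** A list of length [N] is continued with more than [2 * N] members of [A], then
    with the numbers still missing to make it enumerate an initial segment. *)
Lemma crowds_dense A k s : infinite_set A -> exists t, crowds A k (s ++ t).
Proof.
move=> Ai; set l0 := coded (rcons s false); pose N := size l0.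
have AN : infinite_set (A `\` `I_N) by apply: infinite_setD => //; exact: finite_II.
have [B BA Bsize] := infinite_set_fset (2 * N + k.+1) AN.
pose e : seq nat := enum_fset B.
have eA i : i \in e -> A i /\ (N <= i)%N.
  by move=> ie; have [Ai' /negP] := BA i ie; rewrite -leqNgt.
have esize : (2 * N + k.+1 <= size e)%N by exact: Bsize.
pose L := maxn N (\max_(i <- e) i.+1).
pose rest := [seq i <- iota N (L - N) | i \notin e].
pose l := l0 ++ e ++ rest.
have iol0 : iota_perm l0 by exact: coded_iota_perm.
have mem0 i : (i \in l0) = (i < N)%N by rewrite (perm_mem iol0) mem_iota.
have memL i : i \in e -> (i < L)%N.
  by move=> ie; rewrite leq_max orbC (@leq_bigmax_seq _ e xpredT succn).
have lL : perm_eq l (iota 0 L).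
  apply: uniq_perm; last 1 first.
  - move=> i; rewrite !mem_cat mem_filter mem0 !mem_iota add0n /= subnKC ?leq_maxl//.
    have [ie|ie] /= := boolP (i \in e); first by rewrite orbT memL.
    have [iN|Ni] //= := ltnP i N.
    by rewrite (leq_trans iN)// leq_maxl.
  - rewrite !cat_uniq filter_uniq ?iota_uniq// (perm_uniq iol0) iota_uniq fset_uniq /=.
    rewrite andbT; apply/andP; split; apply/hasPn => i.
      rewrite mem_cat mem_filter mem0 mem_iota -leqNgt => /orP[/eA[]//|].
      by case/and3P.
    by rewrite mem_filter => /andP[].
  - exact: iota_uniq.
have [|t st] := @coded_reach s l _ (prefix_prefix _ _).
  by rewrite /iota_perm (perm_size lL) size_iota.
exists t, (N + size e)%N; rewrite st.
  rewrite /l !size_cat addnA leq_addr andbT.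
  by move: esize; rewrite -/N; lia.
move=> q ql.
have : (N + size e <= count_below (q @^-1` A) (N + size e) + N)%N.
  apply: count_below_missing => i /andP[Ni ie] /=; have := ql i.
  rewrite /l !size_cat addnA => <-; last by rewrite ltn_addr.
  rewrite nth_cat ltnNge Ni /= nth_cat ltn_subLR// ie.
  have : nth 0%N e (i - N) \in e by rewrite mem_nth// ltn_subLR.
  by move=> /eA[].
by lia.
Qed.

(** * Densities of permuted sets are reducible to category *)

(** The sequences that are not generic enough for [x]; the parity of the index
    interleaves the requirements for [x] with those for its complement. *)
Definition missed (x : set nat) : set cantor_space :=
  \bigcup_n [set y : cantor_space |
    forall m, ~ crowds (if odd n then x else ~` x) n./2 (mkseq y m)].

Lemma meager_missed x : infinite_set x -> infinite_set (~` x) ->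
  meager (missed x).
Proof.
move=> xi xc; exists (fun n => [set y : cantor_space |
    forall m, ~ crowds (if odd n then x else ~` x) n./2 (mkseq y m)]).
split=> // n; apply: nowhere_dense_avoiding => s.
by apply: crowds_dense; case: odd.
Qed.

Lemma not_missed x y : ~ missed x y -> forall k,
  (exists m, crowds x k (mkseq y m)) /\ (exists m, crowds (~` x) k (mkseq y m)).
Proof.
move=> nm k; split; apply: contrapT => /forallNP H; apply: nm.
  by exists k.*2.+1 => //= m; rewrite odd_double uphalf_double; exact: H.
by exists k.*2 => //= m; rewrite odd_double half_double; exact: H.
Qed.

(** Sequences that code only a finite list get the identity.  The permutation is
    the inverse of the coded bijection because the prefixes of a list decide
    preimages, whereas the relation to be met is about images. *)
Lemma coded_permutation (y : cantor_space) : exists p : symN,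
  (forall k, exists n, (k < size (coded (mkseq y n)))%N) ->
  exists q, [/\ cancel (sval p) q, cancel q (sval p) &
    forall n, agrees q (coded (mkseq y n))].
Proof.
have [unb|bnd] := pselect (forall k, exists n, (k < size (coded (mkseq y n)))%N).
  have [q [p qp pq] qy] := coded_bijection unb.
  by exists (exist _ p (Bijective pq qp)) => _; exists q.
have idb : bijective (@id nat) by exists id.
by exists (exist _ id idb) => /bnd.
Qed.

Theorem density_le_meager (R : realType) : tukey_le (density_sys R) meager_sys.
Proof.
have [phip Hphi] := choice coded_permutation.
have mx (x : setsD R) : meager (missed (sval x)).
  by have [xi xc _] := svalP x; exact: meager_missed.
exists (fun x => exist _ _ (mx x)), phip => x y /= /not_missed gen.
rewrite /density_rel => -[hd _].
have [k|q [pq qp qy]] := Hphi y.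
  have [[n [m /andP[km ms] _]] _] := gen k.
  by exists n; exact: leq_trans ms.
have pre (A : set nat) : sval (phip y) @` A = q @^-1` A.
  apply/seteqP; split=> [_ [i Ai <-]|i Aqi] /=; first by rewrite pq.
  by exists (q i).
apply: (no_density _ _ hd); rewrite pre => k.
  have [[n [m /andP[km _] Hm]] _] := gen k.
  by exists m => //; exact: Hm.
have [_ [n [m /andP[km _] Hm]]] := gen k.
by exists m => //; exact: Hm.
Qed.

Theorem theorem8 (R : realType) :
  exists h0 : nat -> nat,
    forall (h : nat -> nat) (h_ge1 : forall n : nat, (1 <= h n)%N),
      (forall n : nat, (h0 n <= h n)%N) ->
      tukey_le (slalom_sys h_ge1) (density_sys R) /\
      tukey_le (density_sys R) meager_sys.
Proof.
exists (fun n => n * n)%N => h h_ge1 hn; split.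
  exact: slalom_le_density.
exact: density_le_meager.
Qed.
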